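(* Let $p,n,s\in\mathbb{N}$ with $\sqrt{p}\le s\le p$. Set $$\tau(p,s,n)^2 = \frac{\sqrt{p\,\nu_{\mathcal{H}}}}{n},\qquad T := n\sum_{j=1}^p\sum_{k\le\nu_{\mathcal{H}}}X_{k,j}^2.$$ If $\eta\in(0,1)$, then there exists $C_\eta>0$ depending only on $\eta$ such that for all $C>C_\eta$ we have $$P_0\left\{T > p\nu_{\mathcal{H}} + \frac{2}{\sqrt\eta}\sqrt{p\nu_{\mathcal{H}}}\right\} + \sup_{\substack{f\in\mathcal{F}_s,\\ \|f\|_2\ge C\tau(p,s,n)}} P_f\left\{T\le p\nu_{\mathcal{H}}+\frac{2}{\sqrt\eta}\sqrt{p\nu_{\mathcal{H}}}\right\}\le\eta.$$
   Context: Notation: $[p]=\{1,\dots,p\}$. Model: one observes the $p$-dimensional Gaussian white noise model $dY_x = f(x)\,dx + \frac{1}{\sqrt n}\,dB_x$, $x\in[0,1]^p$. $P_f$ denotes the law of the observation when the signal is $f$, and $P_0$ the law when $f\equiv 0$. $\|\cdot\|_2$ is the $L^2([0,1]^p)$ norm. Function space: $\mathcal{H}\subset L^2([0,1])$ is a reproducing kernel Hilbert space (RKHS) whose kernel admits a Mercer expansion. Let $\mathbf 1$ be the constant function one and $\mathcal{H}_0 := \mathcal{H}\cap \mathrm{span}\{\mathbf 1\}^\perp$ (orthogonality in $L^2([0,1])$), also an RKHS, with eigenfunctions $\{\psi_k\}_{k\ge1}$ orthonormal in $L^2([0,1])$ and corresponding eigenvalues $\mu_1\ge\mu_2\ge\dots\ge0$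 in the Mercer expansion of its kernel, so that $\|g\|_{\mathcal{H}_0}^2=\sum_{k\ge1}\mu_k^{-1}\langle g,\psi_k\rangle_{L^2}^2$. It is assumed that $\mu_1=1$. Parameter space: for $S\subset[p]$, $\mathcal{H}_S := \{f(x)=\sum_{j\in S} f_j(x_j): f_j\in\mathcal{H}_0,\ \|f_j\|_{\mathcal{H}_0}\le 1 \text{ for all } j\in S\}$, and $\mathcal{F}_s := \bigcup_{S\subset[p],\,|S|\le s}\mathcal{H}_S$. Truncation level: $\nu_{\mathcal{H}}=\nu_{\mathcal{H}}(p,s,n)$ is the smallest positive integer $\nu$ with $\mu_\nu \le \frac{\sqrt{\nu\log(1+p/s^2)}}{n}$. Data in sequence space: for $k\in\mathbb{N}$, $j\in[p]$, $X_{k,j} := \int_{[0,1]^p}\psi_k(x_j)\,dY_x$; under $P_f$ these are independent with $X_{k,j}\sim N(\theta_{k,j}, n^{-1})$, $\theta_{k,j}=\int_0^1\psi_k(t)f_j(t)\,dt$. *)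

(* Defs.v *)
From HB Require Import structures.
From mathcomp Require Import all_boot all_order all_algebra.
From mathcomp Require Import all_classical all_reals all_analysis.

Set Implicit Arguments.
Unset Strict Implicit.
Unset Printing Implicit Defensive.

Import Order.TTheory GRing.Theory Num.Theory.
Import numFieldNormedType.Exports.

Local Open Scope classical_set_scope.
Local Open Scope ring_scope.

(* Functions on [0,1] and on [0,1]^p are represented by functions on R and on
   Rpow R p; their values off the cube are immaterial, since the two measures
   below are carried by the cube. *)

(* R^p, with the Borel sigma-algebra on which lebesgue_measure is defined. *)
Notation Rpow R p := (p.-tuple (measurableTypeR R)).

Section Cube.
Context {R : realType}.

Definition leb01 : probability (measurableTypeR R) R := uniform_prob (@ltr01 R).

Definition tcons (p : nat) (z : measurableTypeR R * Rpow R p) : Rpow R p.+1 :=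
  [tuple of z.1 :: z.2].

Lemma measurable_tcons p : measurable_fun [set: measurableTypeR R * Rpow R p] (@tcons p).
Proof. by apply: measurable_cons; [exact: measurable_fst|exact: measurable_snd]. Qed.

HB.instance Definition _ p :=
  isMeasurableFun.Build _ _ _ _ (@tcons p) (@measurable_tcons p).

(* Lebesgue measure on [0,1]^p, as a p-fold product. *)
Fixpoint cube_measure (p : nat) : probability (Rpow R p) R :=
  match p with
  | 0%N => dirac [tuple]
  | p'.+1 => distribution (leb01 \x cube_measure p')%E (@tcons p')
  end.

Lemma cube_measure_box p (A : 'I_p -> set (measurableTypeR R)) : (forall i, measurable (A i)) ->
  cube_measure p [set x | forall i, A i (tnth x i)] =
  (\prod_(i < p) leb01 (A i))%E.
Proof.
elim: p A => [|p IH] A mA /=.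
  by rewrite big_ord0 diracE mem_set// => -[].
rewrite /distribution/= /pushforward.
rewrite (_ : _ @^-1` _ = A ord0 `*`
    [set x : Rpow R p | forall i, A (lift ord0 i) (tnth x i)]); last first.
  apply/seteqP; split => -[a x] /=.
    move=> h; split; first exact: (h ord0).
    by move=> i; have := h (lift ord0 i); rewrite /tcons/= tnthS.
  move=> [h0 h] i; have [j ->|-> //] := unliftP ord0 i.
  by rewrite /tcons/= tnthS.
rewrite product_measure1E//; last first.
  rewrite (_ : [set _ | _] = \bigcap_(i in [set: 'I_p])
      ((fun x : Rpow R p => tnth x i) @^-1` A (lift ord0 i))); last first.
    by apply/seteqP; split => x /= h i; [move=> _|]; exact: h.
  apply: fin_bigcap_measurable => // i _; rewrite -[_ @^-1` _]setTI.
  exact: measurable_tnth.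
by rewrite big_ord_recl -IH// => i; exact: mA.
Qed.

End Cube.

Section L2.
Context d {T : measurableType d} {R : realType}.
Variable mu : {measure set T -> \bar R}.

Definition L2 : set (T -> R) := [set f | f \in Lfun mu 2%:E].

Definition L2ip (f g : T -> R) : R := \int[mu]_x (f x * g x).

End L2.

Section RKHS.
Context {R : realType}.

(* H, with inner product ip, is a Hilbert space of functions on [0,1] (elements
   agreeing on [0,1] being identified) with reproducing kernel K. *)
Record is_rkhs (H : set (R -> R)) (ip : (R -> R) -> (R -> R) -> R)
    (K : R -> R -> R) : Prop := IsRKHS {
  rkhs_zero : H (fun=> 0) ;
  rkhs_linear : forall (a : R) f g, H f -> H g -> H (fun x => a * f x + g x) ;
  rkhs_ip_sym : forall f g, H f -> H g -> ip f g = ip g f ;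
  rkhs_ip_linear : forall (a : R) f g h, H f -> H g -> H h ->
    ip (fun x => a * f x + g x) h = a * ip f h + ip g h ;
  rkhs_ip_ge0 : forall f, H f -> 0 <= ip f f ;
  rkhs_ip_eq0 : forall f, H f ->
    ip f f = 0 <-> (forall x, x \in `[0, 1] -> f x = 0) ;
  rkhs_complete : forall u : nat -> R -> R, (forall i, H (u i)) ->
    (forall e : R, 0 < e -> exists N, forall i j, (N <= i)%N -> (N <= j)%N ->
      ip (fun x => u i x - u j x) (fun x => u i x - u j x) < e) ->
    exists2 f, H f &
      (fun i => ip (fun x => u i x - f x) (fun x => u i x - f x)) @ \oo --> 0 ;
  rkhs_kernel : forall x, x \in `[0, 1] -> H (K x) ;
  rkhs_reproducing : forall f x, H f -> x \in `[0, 1] -> ip f (K x) = f x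
}.

(* Eigenpairs are numbered from 0: mu k and psi k stand for the (k+1)-st
   eigenvalue and eigenfunction. *)
Record mercer_expansion (K : R -> R -> R) (mu : nat -> R)
    (psi : nat -> R -> R) : Prop := MercerExpansion {
  mercer_L2 : forall k, L2 leb01 (psi k) ;
  mercer_orthonormal : forall k l, L2ip leb01 (psi k) (psi l) = (k == l)%:R ;
  mercer_ge0 : forall k, 0 <= mu k ;
  mercer_nonincreasing : forall k, mu k.+1 <= mu k ;
  mercer_eigen : forall k x, x \in `[0, 1] ->
    L2ip leb01 (K x) (psi k) = mu k * psi k x ;
  mercer_sum : forall x y, x \in `[0, 1] -> y \in `[0, 1] ->
    (fun N => \sum_(k < N) mu k * psi k x * psi k y) @ \oo --> K x y
}.

Definition perp1 : set (R -> R) := [set g | L2ip leb01 g (fun=> 1) = 0].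

Definition rkhs_norm (ip : (R -> R) -> (R -> R) -> R) (g : R -> R) : R :=
  Num.sqrt (ip g g).

(* H is an RKHS contained in L^2([0,1]) whose kernel has a Mercer expansion;
   H `&` perp1, with the inner product of H, is an RKHS with kernel K0, and
   (mu, psi) is the Mercer eigensystem of K0.  The inverses in [eigen_norm] are
   taken in \bar R, where 0^-1 = +oo and 0 * +oo = 0: an element of H `&` perp1
   has no component along psi k when mu k = 0.  For mu k != 0 the condition
   [eigen_perp1] is automatic. *)
Record additive_rkhs (H : set (R -> R)) (ip : (R -> R) -> (R -> R) -> R)
    (mu : nat -> R) (psi : nat -> R -> R) : Prop := AdditiveRKHS {
  rkhs_sub_L2 : H `<=` L2 leb01 ;
  rkhs_mercer : exists2 K, is_rkhs H ip K &
    exists lam phi, mercer_expansion K lam phi ;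
  rkhs0_mercer : exists2 K0, is_rkhs (H `&` perp1) ip K0 &
    mercer_expansion K0 mu psi ;
  eigen_perp1 : forall k, perp1 (psi k) ;
  eigen_norm : forall g, (H `&` perp1) g ->
    ((rkhs_norm ip g ^+ 2)%:E =
     \sum_(0 <= k <oo) ((mu k)%:E^-1 * (L2ip leb01 g (psi k) ^+ 2)%:E))%E ;
  eigen_first : mu 0 = 1
}.

Definition HS (H : set (R -> R)) ip (p : nat) (S : {set 'I_p}) :
    set (Rpow R p -> R) :=
  [set f | exists g : 'I_p -> R -> R,
    (forall j, j \in S -> (H `&` perp1) (g j) /\ rkhs_norm ip (g j) <= 1) /\
    f = (fun x => \sum_(j in S) g j (tnth x j))].

Definition Fs (H : set (R -> R)) ip (p s : nat) : set (Rpow R p -> R) :=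
  [set f | exists2 S : {set 'I_p}, (#|S| <= s)%N & HS H ip S f].

Definition truncation_cond (mu : nat -> R) (p s n nu : nat) : bool :=
  mu nu.-1 <= Num.sqrt (nu%:R * ln (1 + p%:R / s%:R ^+ 2)) / n%:R.

Definition is_truncation_level (mu : nat -> R) (p s n nu : nat) : Prop :=
  [/\ (0 < nu)%N, truncation_cond mu p s n nu &
      forall nu', (0 < nu')%N -> truncation_cond mu p s n nu' -> (nu <= nu')%N].

End RKHS.

Section WhiteNoise.
Context {R : realType} {d : measure_display} {Om : measurableType d}.

(* Z has law N(m, v) under P; N(m, 0) is the point mass at m, which the library's
   normal_prob does not provide. *)
Definition gaussian (P : probability Om R) (Z : Om -> R) (m v : R) : Prop :=
  forall A : set R, measurable A ->
    P (Z @^-1` A) = (if v == 0 then \d_m A else normal_prob m (Num.sqrt v) A).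

(* The Gaussian white noise experiment dY_x = f(x) dx + n^{-1/2} dB_x, given by
   the Wiener integrals of its observation: P f is the law of the observation
   when the signal is f, and Y h = \int h(x) dY_x for h in L^2([0,1]^p).  Under
   P f, Y is a Gaussian process with E Y(h) = <f, h> and
   Cov(Y(h), Y(h')) = <h, h'> / n; this is expressed by saying that each finite
   linear combination \sum_i c_i Y(h_i) is Gaussian with the mean and variance
   dictated by \sum_i c_i h_i. *)
Record white_noise_model (p n : nat)
    (P : (Rpow R p -> R) -> probability Om R)
    (Y : (Rpow R p -> R) -> Om -> R) : Prop := WhiteNoiseModel {
  white_noise_measurable : forall h, L2 (cube_measure p) h ->
    measurable_fun setT (Y h) ;
  white_noise_law : forall f, L2 (cube_measure p) f ->
    forall (m : nat) (h : 'I_m -> Rpow R p -> R) (c : 'I_m -> R),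
      (forall i, L2 (cube_measure p) (h i)) ->
      let g := fun x => \sum_(i < m) c i * h i x in
      gaussian (P f) (fun w => \sum_(i < m) c i * Y (h i) w)
        (L2ip (cube_measure p) f g)
        (L2ip (cube_measure p) g g / n%:R)
}.

Definition coef (psi : nat -> R -> R) (p : nat)
    (Y : (Rpow R p -> R) -> Om -> R) (k : nat) (j : 'I_p) : Om -> R :=
  Y (fun x => psi k (tnth x j)).

Definition test_stat (psi : nat -> R -> R) (p n nu : nat)
    (Y : (Rpow R p -> R) -> Om -> R) (w : Om) : R :=
  n%:R * \sum_(j < p) \sum_(k < nu) coef psi Y k j w ^+ 2.

End WhiteNoise.

Definition tau {R : realType} (p n nu : nat) : R :=
  Num.sqrt (Num.sqrt (p%:R * nu%:R) / n%:R).

Definition threshold {R : realType} (eta : R) (p nu : nat) : R :=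
  p%:R * nu%:R + 2 / Num.sqrt eta * Num.sqrt (p%:R * nu%:R).

(* Supremum in [0, +oo]; the supremum over an empty set is 0, not -oo. *)
Definition nneg_sup {R : realType} {I : Type} (A : set I) (F : I -> \bar R) : \bar R :=
  ereal_sup ([set 0%E] `|` F @` A).

(* Main.v *)
Require Import Defs.
From HB Require Import structures.
From mathcomp Require Import all_boot all_order all_algebra.
From mathcomp Require Import all_classical all_reals all_analysis.
From mathcomp Require Import measurable_realfun ring lra.

(** In sequence space the statistic is n times the sum of N = p * nu squares of
    Gaussian variables with variance 1/n, whose means are the coefficients of f
    along the functions x |-> psi_k (x_j) with j < p and k < nu.  Let M be the sum
    of the squared means.  Then T has mean N + n M and variance 2 N + 4 n M, and
    both error probabilities follow from Chebyshev's inequality.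

    The variance does not require independence, only that the squares be
    uncorrelated.  This can be read off fourth moments: x^2 y^2 is a linear
    combination of (x + y)^4, (x - y)^4, x^4 and y^4, and the white noise model
    says that X_a + X_b and X_a - X_b are Gaussian
    ([gaussian_sqr_uncorrelated]).  The fourth moment of a Gaussian law comes
    from Stein's identity ([normal_momentS]), and the covariances from the
    orthonormality of the functions psi_k (x_j) in L^2([0,1]^p)
    ([basis_orthonormal]), which uses that every psi_k integrates to 0.

    Under P_0 the mean is N and Chebyshev's inequality at distance
    (2 / sqrt eta) sqrt N gives the bound eta / 2.

    Under the alternative, M must be shown to be large.  For a component g of f,
    the identity |g|_H^2 = sum_k <g, psi_k>^2 / mu_k is polarized and applied to
    g and to the section K0(x, .) of the kernel; the reproducing property turns
    it into the pointwise expansion g(x) = sum_k <g, psi_k> psi_k(x)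
    ([eigen_expansion]).  By Fatou's lemma the energy of g beyond level nu is
    then at most mu_nu |g|_H^2 <= mu_nu ([L2ip_rkhs0_ub]).  The components of f
    are orthogonal, so that |f|^2 <= M + s mu_nu ([signal_energy]), and
    since mu_nu <= mu_(nu - 1), indices starting at 0, the choice of nu together
    with log (1 + x) <= x gives s mu_nu <= sqrt N / n = tau^2
    ([truncation_tail]).  Hence
    n M >= (C^2 - 1) sqrt N, which exceeds the threshold's margin as soon as
    C^2 - 1 >= 64 / eta, and a second use of Chebyshev's inequality, at distance
    M / 2 for T / n, gives at most eta / 2. *)

Set Implicit Arguments.
Unset Strict Implicit.
Unset Printing Implicit Defensive.

Import Order.TTheory GRing.Theory Num.Theory.
Import numFieldNormedType.Exports.

Local Open Scope classical_set_scope.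
Local Open Scope ring_scope.

(** * Moments of Gaussian laws *)

Section GaussianMoments.
Context {R : realType}.
Implicit Types m s : R.

(** Completing the square: an exponential factor only shifts the mean. *)
Lemma normal_pdf_tilt m s t x : s != 0 ->
  expR (t * x) * normal_pdf m s x =
  expR (m * t + s ^+ 2 * t ^+ 2 / 2) * normal_pdf (m + t * s ^+ 2) s x.
Proof.
move=> s0; rewrite !normal_pdfE// /normal_fun.
rewrite mulrCA [RHS]mulrCA -!expRD; congr (_ * expR _).
by field.
Qed.

(** A power of |x| is at most a multiple of e^x + e^(-x), and by
    [normal_pdf_tilt] each of these two factors turns the density into a multiple
    of another normal density.  This gives at once integrability of the moments
    and decay at infinity. *)
Lemma normal_pdf_moment_ub (k : nat) m s x : s != 0 ->
  `|x| ^+ k.+1 * normal_pdf m s x <=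
  k.+1`!%:R * (expR (m + s ^+ 2 / 2) * normal_pdf (m + s ^+ 2) s x +
               expR (- m + s ^+ 2 / 2) * normal_pdf (m - s ^+ 2) s x).
Proof.
move=> s0.
have := normal_pdf_tilt m 1 x s0; have := normal_pdf_tilt m (-1) x s0.
rewrite !(mul1r, mulr1, mulN1r, expr1n, sqrrN, mulrN1) => <- <-.
rewrite -mulrDl mulrA; apply: ler_wpM2r; first exact: normal_pdf_ge0.
rewrite -ler_pdivrMl ?ltr0n ?fact_gt0// mulrC.
apply: (@le_trans _ _ (expR `|x|)).
  by apply: le_trans (expR_ge1Dxn k (normr_ge0 x)); rewrite lerDr.
by case: (ger0P x) => _; rewrite ?lerDl ?lerDr expR_ge0.
Qed.

(** The density is the Radon-Nikodym derivative, almost everywhere. *)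
Lemma integral_normal_prob m s (f : measurableTypeR R -> \bar R) :
  (forall x, 0 <= f x)%E -> measurable_fun setT f ->
  (\int[normal_prob m s]_x f x =
   \int[lebesgue_measure]_x (f x * (normal_pdf m s x)%:E))%E.
Proof.
move=> f0 mf.
have dom : normal_prob m s `<< lebesgue_measure by exact: normal_prob_dominates.
rewrite -(Radon_Nikodym_SigmaFinite.change_of_variables dom)//.
have mpdf : measurable_fun setT (EFin \o normal_pdf m s).
  by apply/measurable_EFinP; exact: measurable_normal_pdf.
apply: ae_eq_integral => //.
- apply: emeasurable_funM => //.
  exact: measurable_int (Radon_Nikodym_SigmaFinite.f_integrable dom).
- exact: emeasurable_funM.
- apply: ae_eqe_mul2l; apply: integral_ae_eq => //.
  + exact: Radon_Nikodym_SigmaFinite.f_integrable.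
  + by move=> E _ mE; rewrite -Radon_Nikodym_SigmaFinite.f_integral.
Qed.

Lemma integrable_moment (k : nat) m s : s != 0 ->
  lebesgue_measure.-integrable setT
    (fun x : R => (x ^+ k * normal_pdf m s x)%:E).
Proof.
move=> s0; case: k => [|k].
  by under eq_fun do rewrite expr0 mul1r; exact: integrable_normal_pdf.
pose g x := k.+1`!%:R * (expR (m + s ^+ 2 / 2) * normal_pdf (m + s ^+ 2) s x +
               expR (- m + s ^+ 2 / 2) * normal_pdf (m - s ^+ 2) s x).
apply: (@le_integrable _ _ _ lebesgue_measure _ _ _ (EFin \o g)) => //.
- apply/measurable_EFinP; apply: measurable_funM; first exact: measurable_funX.
  exact: measurable_normal_pdf.
- move=> x _ /=; rewrite lee_fin normrM normrX.
  rewrite (ger0_norm (normal_pdf_ge0 _ _ _)).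
  by apply: le_trans (ler_norm _); exact: normal_pdf_moment_ub.
- have -> : EFin \o g = (fun x => k.+1`!%:R%:E *
      ((expR (m + s ^+ 2 / 2))%:E * (normal_pdf (m + s ^+ 2) s x)%:E +
       (expR (- m + s ^+ 2 / 2))%:E * (normal_pdf (m - s ^+ 2) s x)%:E))%E.
    by apply/funext => x; rewrite /g /= EFinM EFinD !EFinM.
  apply: integrableZl => //; apply: integrableD => //;
    by apply: integrableZl => //; exact: integrable_normal_pdf.
Qed.

(** The fundamental theorem on [-n, n] and dominated convergence; used as an
    integration by parts on the whole line. *)
Lemma integral_derive_eq0 (F f : R -> R) :
  continuous f -> (forall x, is_derive x (1 : R) F (f x)) ->
  lebesgue_measure.-integrable setT (EFin \o f) ->
  (fun n : nat => F n%:R) @ \oo --> 0 -> (fun n : nat => F (- n%:R)) @ \oo --> 0 ->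
  \int[lebesgue_measure]_x f x = 0.
Proof.
move=> cf dF intf F0 FN0.
pose D (n : nat) : set R := `[- n%:R, n%:R]%classic.
have mD n : measurable (D n) by exact: measurable_itv.
have cvgI : (fun n => \int[lebesgue_measure]_x ((EFin \o f) \_ (D n)) x)%E
    @ \oo --> (\int[lebesgue_measure]_x (f x)%:E)%E.
  have [|||||_ _ h] := @dominated_convergence _ _ _ lebesgue_measure setT
    measurableT (fun n => (EFin \o f) \_ (D n)) (EFin \o f) (abse \o (EFin \o f)).
  - move=> n; apply/(measurable_restrictT _ (mD n)).
    exact: measurable_funTS (measurable_int _ intf).
  - exact: measurable_int intf.
  - apply: aeW => x _; apply: cvg_near_cst.
    exists (Num.truncn `|x|).+1 => // n /= xn; rewrite patchE mem_set// /D /= in_itv/=.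
    rewrite -ler_norml; apply: ltW; apply: lt_le_trans (truncnS_gt _) _.
    by rewrite ler_nat.
  - exact: integrable_abse.
  - apply: aeW => x n _; rewrite patchE; case: ifP => _ //=.
    by rewrite normr0 lee_fin.
  exact: h.
have EI n : (0 < n)%N ->
    (\int[lebesgue_measure]_x ((EFin \o f) \_ (D n)) x)%E =
    (F n%:R - F (- n%:R))%:E.
  move=> n0; rewrite -integral_mkcond /=.
  have cF : continuous F.
    by move=> x; apply: differentiable_continuous; apply/derivable1_diffP.
  rewrite (continuous_FTC2 (F := F)) ?EFinB//.
  - by rewrite gtrN// ltr0n.
  - exact: continuous_subspaceT.
  - split=> //.
    + by apply: cvg_at_right_filter; exact: cF.
    + by apply: cvg_at_left_filter; exact: cF.
  - by move=> x _; rewrite derive1E; exact: derive_val.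
have cvg0 : (fun n => \int[lebesgue_measure]_x ((EFin \o f) \_ (D n)) x)%E
    @ \oo --> 0%E.
  have h : (fun n => (F n%:R - F (- n%:R))%:E) @ \oo --> 0%:E.
    apply: cvg_EFin; first exact: nearW.
    by rewrite -(subr0 0); apply: (@cvgB _ R^o).
  apply: cvg_trans h; apply: near_eq_cvg.
  by exists 1%N => // n /= n0; rewrite EI.
by rewrite /Rintegral -(cvg_lim _ cvgI)// (cvg_lim _ cvg0).
Qed.

Definition normal_moment m s (k : nat) : R :=
  \int[lebesgue_measure]_x (x ^+ k * normal_pdf m s x).

Lemma normal_moment0 m s : normal_moment m s 0 = 1.
Proof.
rewrite /normal_moment /Rintegral; under eq_integral do rewrite expr0 mul1r.
by rewrite integral_normal_pdf.
Qed.

Lemma is_derive_normal_pdf m s x : s != 0 ->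
  is_derive x (1 : R) (normal_pdf m s) (- ((x - m) / s ^+ 2) * normal_pdf m s x).
Proof.
move=> s0; rewrite !normal_pdfE// /normal_fun.
apply: is_derive_eq.
by rewrite /GRing.scale/=; field.
Qed.

Lemma normal_pdf_decay (k : nat) m s : s != 0 ->
  exists2 c : R, 0 <= c & forall x, 0 < `|x| -> `|x ^+ k * normal_pdf m s x| <= c / `|x|.
Proof.
move=> s0.
exists (k.+1`!%:R * (expR (m + s ^+ 2 / 2) * normal_peak s +
               expR (- m + s ^+ 2 / 2) * normal_peak s)).
  by rewrite mulr_ge0// addr_ge0// mulr_ge0 ?expR_ge0 ?normal_peak_ge0.
move=> x x0; rewrite ler_pdivlMr// normrM normrX mulrAC -exprSr.
rewrite (ger0_norm (normal_pdf_ge0 _ _ _)).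
apply: le_trans (normal_pdf_moment_ub k m x s0) _.
by rewrite ler_wpM2l// lerD// ler_wpM2l ?expR_ge0// normal_pdf_ub.
Qed.

Lemma cvg_normr_le_harmonic (c : R) (u : nat -> R) :
  (forall n, (0 < n)%N -> `|u n| <= c / n%:R) -> u @ \oo --> (0 : R).
Proof.
move=> uc.
have h : (fun n : nat => c * n.+1%:R^-1) @ \oo --> (0 : R).
  by rewrite -(mulr0 c); apply: cvgM; [exact: cvg_cst|exact: cvg_harmonic].
rewrite -cvg_shiftS; apply: norm_cvg0.
apply: (squeeze_cvgr _ (@cvg_cst _ _ _ _ _) h).
by apply: nearW => n; rewrite normr_ge0 uc.
Qed.

(** Stein's identity E[(X - m) X^k] = s^2 k E[X^(k-1)], obtained by integrating
    the derivative of x^k times the density.  For k = 0 the predecessor is 0 and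
    the last term vanishes. *)
Lemma normal_momentS (k : nat) m s : s != 0 ->
  normal_moment m s k.+1 = m * normal_moment m s k + s ^+ 2 * k%:R * normal_moment m s k.-1.
Proof.
move=> s0.
pose g j x := x ^+ j * normal_pdf m s x.
pose f x := k%:R * g k.-1 x + (- s ^- 2 * g k.+1 x + m / s ^+ 2 * g k x).
have cg j : continuous (g j).
  by move=> x; apply: cvgM; [exact: exprn_continuous|exact: continuous_normal_pdf].
have ig j : lebesgue_measure.-integrable setT (EFin \o g j).
  exact: integrable_moment.
have iZ (a : R) j : lebesgue_measure.-integrable setT (EFin \o (fun x => a * g j x)).
  have -> : EFin \o (fun x => a * g j x) = (fun x => a%:E * (g j x)%:E)%E by [].
  exact: (integrableZl measurableT _ (ig j)).
have i2 : lebesgue_measure.-integrable setT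
    (EFin \o (fun x => - s ^- 2 * g k.+1 x + m / s ^+ 2 * g k x)).
  exact: (integrableD measurableT (iZ _ _) (iZ _ _)).
have [c c0 gc] := normal_pdf_decay k m s0.
have : \int[lebesgue_measure]_x f x = 0.
  apply: (integral_derive_eq0 (F := g k)).
  - move=> x; apply: cvgD; last apply: cvgD;
      by apply: cvgM; [exact: cvg_cst|exact: cg].
  - move=> x; have dp := is_derive_normal_pdf m x s0.
    have dX : is_derive x (1 : R) (fun y : R => y ^+ k) (k%:R * x ^+ k.-1).
      have -> : (fun y : R => y ^+ k) = id ^+ k by apply/funext => y; rewrite exprfctE.
      rewrite -[k%:R * _]mulr1; exact: (is_deriveX k (is_derive_id x (1 : R))).
    have -> : g k = (fun y : R => y ^+ k) * normal_pdf m s by [].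
    apply: is_derive_eq; rewrite /f /g /GRing.scale/=.
    by rewrite (exprSr x); field.
  - rewrite /f; exact: (integrableD measurableT (iZ k%:R k.-1) i2).
  - apply: (cvg_normr_le_harmonic (c := c)) => n n0.
    rewrite -[in leRHS](ger0_norm (ler0n R n)).
    by apply: gc; rewrite normr_gt0 pnatr_eq0 -lt0n.
  - apply: (cvg_normr_le_harmonic (c := c)) => n n0.
    rewrite -[in leRHS](ger0_norm (ler0n R n)) -[in leRHS]normrN.
    by apply: gc; rewrite normrN normr_gt0 pnatr_eq0 -lt0n.
rewrite RintegralD// RintegralD// !RintegralZl//.
rewrite -!/(normal_moment m s _) => h.
have -> : normal_moment m s k.+1 = s ^+ 2 * (s ^- 2 * normal_moment m s k.+1) by field.
rewrite (_ : s ^- 2 * normal_moment m s k.+1 = k%:R * normal_moment m s k.-1 +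
  m / s ^+ 2 * normal_moment m s k); first by field.
by apply/eqP; rewrite -subr_eq0 -oppr_eq0; apply/eqP; rewrite -[RHS]h; field.
Qed.

Lemma normal_moment2 m s : s != 0 -> normal_moment m s 2 = m ^+ 2 + s ^+ 2.
Proof. by move=> s0; rewrite !normal_momentS//= normal_moment0; ring. Qed.

Lemma normal_moment4 m s : s != 0 ->
  normal_moment m s 4 = m ^+ 4 + 6 * m ^+ 2 * s ^+ 2 + 3 * s ^+ 4.
Proof. by move=> s0; rewrite !normal_momentS//= normal_moment0; ring. Qed.

Section gaussian.
Context {d : measure_display} {Om : measurableType d}.
Variables (P : probability Om R) (Z : Om -> R) (m v : R).
Hypotheses (v0 : 0 < v) (mZ : measurable_fun setT Z) (gZ : gaussian P Z m v).

Let s := Num.sqrt v.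
Let s0 : s != 0. Proof. by rewrite gt_eqF// sqrtr_gt0. Qed.

Lemma ge0_gaussian_integral (f : R -> \bar R) : (forall x, 0 <= f x)%E ->
  measurable_fun setT f ->
  (\int[P]_w f (Z w) =
   \int[lebesgue_measure]_x (f x * (normal_pdf m s x)%:E))%E.
Proof.
move=> f0 mf; rewrite -integral_normal_prob//.
have mZ' : @measurable_fun _ _ Om (measurableTypeR R) setT Z by exact: mZ.
pose Zf := isMeasurableFun.Build _ _ _ _ _ mZ'.
pose Z' : {mfun Om >-> measurableTypeR R} := HB.pack Z Zf.
rewrite -(@ge0_integral_distribution _ _ _ _ _ P Z' f)//.
apply: eq_measure_integral => A mA _.
rewrite [LHS](gZ mA) gt_eqF//.
Qed.

Lemma gaussian_integrable (k : nat) :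
  P.-integrable setT (fun w => (Z w ^+ k)%:E).
Proof.
apply/integrableP; split.
  by apply/measurable_EFinP; exact: measurable_funX.
rewrite (ge0_gaussian_integral (f := fun x => `|(x ^+ k)%:E|)%E)//; last first.
  by apply: measurableT_comp => //; apply/measurable_EFinP; exact: measurable_funX.
have /integrableP[_] := integrable_moment k m s0.
apply: le_lt_trans; rewrite le_eqVlt; apply/predU1P; left.
apply: eq_integral => x _.
by rewrite [in RHS]EFinM abseM [X in (_ = _ * X)%E]gee0_abs ?lee_fin ?normal_pdf_ge0.
Qed.

Lemma gaussian_moment (k : nat) : ~~ odd k ->
  \int[P]_w (Z w ^+ k) = normal_moment m s k.
Proof.
move=> ek; rewrite /Rintegral.
by rewrite (ge0_gaussian_integral (f := fun x => (x ^+ k)%:E))// => [x|];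
  [rewrite lee_fin exprn_even_ge0//|apply/measurable_EFinP; exact: measurable_funX].
Qed.

Lemma gaussian_sqr : \int[P]_w (Z w ^+ 2) = m ^+ 2 + v.
Proof. by rewrite gaussian_moment// normal_moment2// sqr_sqrtr// ltW. Qed.

Lemma gaussian_fourth : \int[P]_w (Z w ^+ 4) = m ^+ 4 + 6 * m ^+ 2 * v + 3 * v ^+ 2.
Proof.
rewrite gaussian_moment// normal_moment4//.
by rewrite (exprM s 2 2) sqr_sqrtr// ltW.
Qed.

End gaussian.
End GaussianMoments.

(** * Square-integrable functions and laws of random variables *)

Section L2Basics.
Context {d} {T : measurableType d} {R : realType}.
Variable mu : {measure set T -> \bar R}.
Implicit Types f g h : T -> R.

Lemma L2_measurable f : L2 mu f -> measurable_fun setT f.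
Proof. by move=> /sub_Lfun_mfun; rewrite inE. Qed.

Lemma Lnorm2_sqr f : ('N[mu]_2%:E[EFin \o f] `^ 2 = \int[mu]_x (f x ^+ 2)%:E)%E.
Proof.
rewrite powR_Lnorm//; apply: eq_integral => x _ /=.
by rewrite powR_mulrn// real_normK// num_real.
Qed.

Lemma L2P f : measurable_fun setT f ->
  mu.-integrable setT (fun x => (f x ^+ 2)%:E) -> L2 mu f.
Proof.
move=> mf /integrableP[_ fi]; apply/andP; split; first by rewrite inE.
rewrite inE /= /finite_norm (@lty_poweRy _ _ 2)// Lnorm2_sqr.
apply: le_lt_trans fi; rewrite le_eqVlt; apply/predU1P; left.
by apply: eq_integral => x _; rewrite gee0_abs// lee_fin sqr_ge0.
Qed.

Lemma L2_integrableM f g : L2 mu f -> L2 mu g ->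
  mu.-integrable setT (fun x => (f x * g x)%:E).
Proof. by move=> f2 g2; apply/Lfun1_integrable; exact: Lfun2_mul_Lfun1. Qed.

Lemma L2_0 : L2 mu (fun=> 0).
Proof. by apply: L2P => //; under eq_fun do rewrite expr0n; exact: integrable0. Qed.

Lemma L2D f g : L2 mu f -> L2 mu g -> L2 mu (fun x => f x + g x).
Proof.
move=> f2 g2.
have p1 : (1 <= 2%:E :> \bar R)%E by rewrite lee_fin ler1n.
exact: (Lfun_addr_closed mu p1).2 f2 g2.
Qed.

Lemma L2Z a f : L2 mu f -> L2 mu (fun x => a * f x).
Proof.
move=> f2; under eq_fun do rewrite mulrC.
by apply: (Lfun_scale a _ f2); rewrite ler1n.
Qed.

Lemma L2_sum (I : Type) (r : seq I) (Q : pred I) (f : I -> T -> R) :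
  (forall i, Q i -> L2 mu (f i)) -> L2 mu (fun x => \sum_(i <- r | Q i) f i x).
Proof.
move=> f2; elim: r => [|i r IH].
  by under eq_fun do rewrite big_nil; exact: L2_0.
case Qi: (Q i); last by under eq_fun do rewrite big_cons Qi.
by under eq_fun do rewrite big_cons Qi; apply: L2D => //; exact: f2.
Qed.

Lemma L2ipC f g : L2ip mu f g = L2ip mu g f.
Proof. by apply: eq_Rintegral => x _; rewrite mulrC. Qed.

Lemma L2ipDl f g h : L2 mu f -> L2 mu g -> L2 mu h ->
  L2ip mu (fun x => f x + g x) h = L2ip mu f h + L2ip mu g h.
Proof.
move=> f2 g2 h2; rewrite -RintegralD//; first 1 last.
- exact: L2_integrableM.
- exact: L2_integrableM.
by apply: eq_Rintegral => x _; rewrite mulrDl.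
Qed.

Lemma L2ipZl a f h : L2 mu f -> L2 mu h ->
  L2ip mu (fun x => a * f x) h = a * L2ip mu f h.
Proof.
move=> f2 h2; rewrite -RintegralZl//; last exact: L2_integrableM.
by apply: eq_Rintegral => x _; rewrite mulrA.
Qed.

Lemma L2ip_suml (I : Type) (r : seq I) (Q : pred I) (f : I -> T -> R) h :
  (forall i, Q i -> L2 mu (f i)) -> L2 mu h ->
  L2ip mu (fun x => \sum_(i <- r | Q i) f i x) h = \sum_(i <- r | Q i) L2ip mu (f i) h.
Proof.
move=> f2 h2; elim: r => [|i r IH].
  rewrite big_nil /L2ip; under eq_Rintegral do rewrite big_nil mul0r.
  by rewrite Rintegral_cst// mul0r.
rewrite big_cons -IH; case Qi: (Q i).
- under [X in L2ip mu X _]eq_fun do rewrite big_cons Qi.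
  by rewrite L2ipDl//; [exact: f2|exact: L2_sum].
- by under [X in L2ip mu X _]eq_fun do rewrite big_cons Qi.
Qed.

Lemma EFin_L2ip f : L2 mu f -> ((L2ip mu f f)%:E = \int[mu]_x (f x ^+ 2)%:E)%E.
Proof.
move=> f2; rewrite /L2ip /Rintegral fineK//.
exact/integrable_fin_num/L2_integrableM.
Qed.

Lemma Lnorm2_ge f c : 0 <= c -> L2 mu f ->
  (c%:E <= 'N[mu]_2%:E[EFin \o f])%E -> c ^+ 2 <= L2ip mu f f.
Proof.
move=> c0 f2 cf; rewrite -lee_fin EFin_L2ip// -Lnorm2_sqr.
rewrite -powR_mulrn// -poweR_EFin; apply: gt0_ler_poweR => //.
- by rewrite in_itv/= lee_fin c0 leey.
- by rewrite in_itv/= Lnorm_ge0 leey.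
Qed.

End L2Basics.

Section Chebyshev.
Context {R : realType} {d : measure_display} {Om : measurableType d}.
Variable P : probability Om R.

(** Stated with the raw second moment, so that the bound is an inner product
    to which bilinearity applies. *)
Lemma chebyshev_L2 (Z : Om -> R) (t : R) : 0 < t -> L2 P Z ->
  (P [set w | (t <= `|Z w|)%R] <= (L2ip P Z Z / t ^+ 2)%:E)%E.
Proof.
move=> t0 Z2; have mZ := L2_measurable Z2.
pose Zf := isMeasurableFun.Build _ _ _ _ _ mZ.
pose Z' : {mfun Om >-> R} := HB.pack Z Zf.
rewrite EFinM muleC lee_pdivlMl ?exprn_gt0// EFin_L2ip//.
have := @markov _ _ _ P Z' (fun x => x ^+ 2) t t0.
rewrite unlock => h; apply: le_trans (h _ _ _) _ => //.
- by move=> r _; exact: sqr_ge0.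
- by move=> x y; rewrite !nnegrE => x0 y0; rewrite ler_sqr.
rewrite le_eqVlt; apply/predU1P; left; apply: eq_integral => w _ /=.
by rewrite real_normK// num_real.
Qed.

End Chebyshev.

Section Law.
Context {d d'} {T : measurableType d} {T' : measurableType d'} {R : realType}.
Variables (P : probability T R) (X : {mfun T >-> T'}) (Q : probability T' R).
Hypothesis lawX : forall A, measurable A -> P (X @^-1` A) = Q A.

Lemma ge0_integral_law (f : T' -> \bar R) : measurable_fun setT f ->
  (forall y, 0 <= f y)%E -> (\int[P]_x f (X x) = \int[Q]_y f y)%E.
Proof.
move=> mf f0; rewrite -(ge0_integral_distribution X)//.
by apply: eq_measure_integral => A mA _; exact: lawX.
Qed.

Lemma integrable_law (f : T' -> R) : Q.-integrable setT (EFin \o f) ->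
  P.-integrable setT (EFin \o (f \o X)).
Proof.
move=> /integrableP[mf fi]; apply/integrableP; split.
  exact: (measurableT_comp mf (measurable_funPT X)).
by rewrite (ge0_integral_law (f := fun y => `|(f y)%:E|)%E)//; exact: measurableT_comp.
Qed.

Lemma Rintegral_law (f : T' -> R) : Q.-integrable setT (EFin \o f) ->
  \int[P]_x f (X x) = \int[Q]_y f y.
Proof.
move=> fi; congr fine.
rewrite -[LHS](@integral_distribution _ _ _ _ _ P X (EFin \o f)).
- by apply: eq_measure_integral => A mA _; exact: lawX.
- exact: measurable_int fi.
- exact: integrable_law.
Qed.

End Law.

Lemma measurable_preimage_ge {R : realType} {d : measure_display}
    {Om : measurableType d} (Z : Om -> R) c : measurable_fun setT Z ->
  measurable [set w | c <= Z w].
Proof.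
move=> mZ; rewrite (_ : [set _ | _] = setT `&` Z @^-1` `[c, +oo[%classic).
  exact: mZ.
by rewrite setTI; apply/seteqP; split => w /=; rewrite in_itv/= andbT.
Qed.

Lemma measurable_preimage_le {R : realType} {d : measure_display}
    {Om : measurableType d} (Z : Om -> R) c : measurable_fun setT Z ->
  measurable [set w | Z w <= c].
Proof.
move=> mZ; rewrite (_ : [set _ | _] = setT `&` Z @^-1` `]-oo, c]%classic).
  exact: mZ.
by rewrite setTI; apply/seteqP; split => w /=; rewrite in_itv.
Qed.

(** * Coordinates on the cube *)

Section CubeCoordinates.
Context {R : realType}.
Variable p : nat.
Implicit Types (i j : 'I_p) (g h : R -> R).
Notation cube := (cube_measure p : probability (Rpow R p) R).

Definition coord i (x : Rpow R p) : measurableTypeR R := tnth x i.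
Definition coord2 i j (x : Rpow R p) : measurableTypeR R * measurableTypeR R :=
  (tnth x i, tnth x j).

Lemma measurable_coord i : measurable_fun setT (coord i).
Proof. exact: measurable_tnth. Qed.

Lemma measurable_coord2 i j : measurable_fun setT (coord2 i j).
Proof. by apply: measurable_fun_pair; exact: measurable_tnth. Qed.

HB.instance Definition _ i :=
  isMeasurableFun.Build _ _ _ _ (coord i) (measurable_coord i).
HB.instance Definition _ i j :=
  isMeasurableFun.Build _ _ _ _ (coord2 i j) (measurable_coord2 i j).

Lemma law_coord i (A : set (measurableTypeR R)) : measurable A ->
  cube (coord i @^-1` A) = leb01 A.
Proof.
move=> mA; pose B k : set (measurableTypeR R) := if k == i then A else setT.
have mB k : measurable (B k) by rewrite /B; case: ifP.
transitivity (cube [set x | forall k, B k (tnth x k)]).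
  congr (cube _); apply/seteqP; split => x /=; last first.
    by move=> /(_ i); rewrite /B eqxx.
  by move=> Ax k; rewrite /B; case: eqP => // ->.
rewrite cube_measure_box// (bigD1 i)//= /B eqxx big1 ?mule1// => k /negbTE ->.
exact: probability_setT.
Qed.

(** Distinct coordinates are independent: both measures agree on rectangles. *)
Lemma law_coord2 i j : i != j ->
  forall A : set (measurableTypeR R * measurableTypeR R), measurable A ->
  cube (coord2 i j @^-1` A) = (leb01 \x leb01)%E A.
Proof.
move=> ij A mA; rewrite -[LHS]/(distribution cube (coord2 i j) A).
symmetry; apply: product_measure_unique => // {mA}A {}B mA mB.
pose D k : set (measurableTypeR R) :=
  if k == i then A else if k == j then B else setT.
have mD k : measurable (D k) by rewrite /D; case: ifP => // _; case: ifP.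
transitivity (cube [set x | forall k, D k (tnth x k)]).
  congr (cube _); apply/seteqP; split => x /=; last first.
    move=> Dx; split; first by have := Dx i; rewrite /D eqxx.
    by have := Dx j; rewrite /D eq_sym (negbTE ij) eqxx.
  by move=> [Ax Bx] k; rewrite /D; case: eqP => [->//|_]; case: eqP => [->//|_].
rewrite cube_measure_box// (bigD1 i)//= (bigD1 j)/=; last by rewrite eq_sym.
rewrite {1 2}/D eqxx eq_sym (negbTE ij) eqxx big1 ?mule1// => k /andP[ki kj].
by rewrite /D (negbTE ki) (negbTE kj) probability_setT.
Qed.

Lemma L2_coord i g : L2 leb01 g -> L2 cube (fun x => g (tnth x i)).
Proof.
move=> g2; apply: L2P.
    exact: (measurableT_comp (L2_measurable g2) (measurable_coord i)).
exact: (integrable_law (law_coord i) (f := fun y => g y ^+ 2)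
  (Lfun2_integrable_sqr g2)).
Qed.

Lemma L2ip_coord i g h : L2 leb01 g -> L2 leb01 h ->
  L2ip cube (fun x => g (tnth x i)) (fun x => h (tnth x i)) = L2ip leb01 g h.
Proof.
move=> g2 h2.
exact: (Rintegral_law (law_coord i) (f := fun y => g y * h y)
  (L2_integrableM g2 h2)).
Qed.

Lemma L2_cst (c : R) : L2 (leb01 : probability (measurableTypeR R) R) (fun=> c).
Proof. exact: Lfun_cst. Qed.

(** Fubini on the law of the pair of coordinates. *)
Lemma L2ip_coord2 i j g h : i != j -> L2 leb01 g -> L2 leb01 h ->
  L2ip cube (fun x => g (tnth x i)) (fun x => h (tnth x j)) =
  L2ip leb01 g (fun=> 1) * L2ip leb01 h (fun=> 1).
Proof.
move=> ij g2 h2.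
pose f (z : measurableTypeR R * measurableTypeR R) := g z.1 * h z.2.
have mg := L2_measurable g2; have mh := L2_measurable h2.
have mf : measurable_fun setT f.
  by apply: measurable_funM; exact: measurableT_comp.
have i1 (k : measurableTypeR R -> R) : L2 leb01 k -> leb01.-integrable setT (EFin \o k).
  move=> k2; have := L2_integrableM k2 (L2_cst 1).
  by under eq_fun do rewrite mulr1.
have intf : ((leb01 \x leb01)%E : {measure set _ -> \bar R}).-integrable setT (EFin \o f).
  apply/integrable12ltyP; first exact/measurable_EFinP.
  rewrite (eq_integral (fun x : measurableTypeR R =>
    (\int[leb01]_y `|(h y)%:E|) * `|(g x)%:E|)%E); last first.
    move=> x _ /=; rewrite /f/=.
    under eq_integral do rewrite normrM EFinM.
    rewrite ge0_integralZl; [|exact: measurableT| |by []|exact: normr_ge0].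
      by rewrite [RHS]muleC.
    by apply/measurable_EFinP; exact: measurableT_comp.
  rewrite ge0_integralZl//; last 2 first.
    by apply/measurable_EFinP; exact: measurableT_comp.
    by apply: integral_ge0 => x _; rewrite lee_fin.
  have /integrableP[_ hg] := i1 _ g2; have /integrableP[_ hh] := i1 _ h2.
  rewrite lte_mul_pinfty; [by []|by apply: integral_ge0| |by []].
  by rewrite ge0_fin_numE//; exact: integral_ge0.
rewrite [LHS](Rintegral_law (law_coord2 ij) intf).
have E (k : measurableTypeR R -> R) : L2ip leb01 k (fun=> 1) = \int[leb01]_x k x :> R.
  by apply: eq_Rintegral => x _; rewrite mulr1.
rewrite !E /Rintegral -(integral12_prod_meas1 intf).
rewrite (eq_integral (fun x : measurableTypeR R =>
  ((\int[leb01]_y (h y)%:E) * (g x)%:E))%E); last first.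
  move=> x _; rewrite /fubini_F /f/=.
  under eq_integral do rewrite EFinM.
  by rewrite integralZl; [rewrite [RHS]muleC|exact: measurableT|exact: i1].
have hf : (\int[leb01]_y (h y)%:E)%E \is a fin_num.
  exact: integrable_fin_num (i1 _ h2).
rewrite -(fineK hf) integralZl//; last exact: i1.
rewrite fineM; [by rewrite [RHS]mulrC|by []|].
exact: integrable_fin_num (i1 _ g2).
Qed.

End CubeCoordinates.

(** * Expansion of the functions of the RKHS in the eigenfunctions *)

Section EigenExpansion.
Context {R : realType}.
Variables (H : set (R -> R)) (ip : (R -> R) -> (R -> R) -> R).
Variables (mu : nat -> R) (psi : nat -> R -> R).
Hypothesis Hrkhs : additive_rkhs H ip mu psi.
Implicit Types g h : R -> R.

Notation H0 := (H `&` perp1).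
Notation theta g k := (L2ip leb01 g (psi k)).

Lemma eigen_L2 k : L2 leb01 (psi k).
Proof. by case: (rkhs0_mercer Hrkhs) => K0 _ /mercer_L2. Qed.

Lemma rkhs0_L2 g : H0 g -> L2 leb01 g.
Proof. by move=> [+ _]; exact: (rkhs_sub_L2 Hrkhs). Qed.

Lemma eigenvalue_ge0 k : 0 <= mu k.
Proof. by case: (rkhs0_mercer Hrkhs) => K0 _ /mercer_ge0. Qed.

Lemma eigenvalue_nonincreasing k l : (k <= l)%N -> mu l <= mu k.
Proof.
have [K0 _ /mercer_nonincreasing M] := rkhs0_mercer Hrkhs.
by move/(nonincreasing_seqP mu).1; apply; exact: M.
Qed.

Lemma rkhs0_ip_ge0 g : H0 g -> 0 <= ip g g.
Proof.
by case: (rkhs0_mercer Hrkhs) => K0 rk _ ?; exact: (rkhs_ip_ge0 rk).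
Qed.

Let eterm g k : \bar R := ((mu k)%:E^-1 * (theta g k ^+ 2)%:E)%E.

Let eterm_ge0 g k : (0 <= eterm g k)%E.
Proof.
by rewrite mule_ge0 ?lee_fin ?sqr_ge0// inve_ge0 lee_fin eigenvalue_ge0.
Qed.

Let sum_eterm g : H0 g -> (\sum_(0 <= k <oo) eterm g k = (ip g g)%:E)%E.
Proof.
by move=> Hg; rewrite -(eigen_norm Hrkhs) ?/rkhs_norm// sqr_sqrtr// rkhs0_ip_ge0.
Qed.

(** In the extended reals the term of index k would be infinite otherwise, while
    the sum is finite.  Since real inversion sends 0 to 0, this makes the real
    series below agree with the extended one. *)
Lemma theta_eq0 g k : H0 g -> mu k = 0 -> theta g k = 0.
Proof.
move=> Hg mu0; apply: contrapT => /eqP th0.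
have := sum_eterm Hg; rewrite (nneseries_pinfty (k := k))//.
by rewrite /eterm mu0 inve0 mulyr gtr0_sg ?mul1e// exprn_even_gt0.
Qed.

Lemma eigen_norm_cvg g : H0 g ->
  (fun N => \sum_(k < N) (mu k)^-1 * theta g k ^+ 2) @ \oo --> ip g g.
Proof.
move=> Hg; have etE k : eterm g k = ((mu k)^-1 * theta g k ^+ 2)%:E.
  rewrite /eterm; have [m0|m0] := eqVneq (mu k) 0.
    by rewrite (theta_eq0 Hg m0) expr0n/= mulr0 mule0.
  by rewrite inver (negbTE m0).
have : (fun N => \sum_(0 <= k < N) eterm g k)%E @ \oo --> (ip g g)%:E.
  rewrite -(sum_eterm Hg); apply: is_cvg_nneseries => n _ _; exact: eterm_ge0.
move/fine_cvg; apply: cvg_trans; apply: near_eq_cvg; apply: nearW => N /=.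
by under eq_bigr do rewrite etE; rewrite sumEFin/= big_mkord.
Qed.

(** Polarization of [eigen_norm_cvg]. *)
Lemma eigen_ip_cvg g h : H0 g -> H0 h ->
  (fun N => \sum_(k < N) (mu k)^-1 * (theta g k * theta h k)) @ \oo --> ip g h.
Proof.
move=> Hg Hh; have [K0 rk _] := rkhs0_mercer Hrkhs.
have Hgh := rkhs_linear rk 1 Hg Hh.
have ipgh : ip g h = 2^-1 * (ip (fun x => 1 * g x + h x) (fun x => 1 * g x + h x)
    - ip g g - ip h h).
  have e f : H0 f -> ip (fun x => 1 * g x + h x) f = ip g f + ip h f.
    by move=> Hf; rewrite (rkhs_ip_linear rk)// mul1r.
  rewrite e// (rkhs_ip_sym rk Hg Hgh) (rkhs_ip_sym rk Hh Hgh) !e//.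
  by rewrite (rkhs_ip_sym rk Hh Hg); field.
have thD k : theta (fun x => 1 * g x + h x) k = theta g k + theta h k.
  rewrite L2ipDl ?L2ipZl ?mul1r//; try exact: eigen_L2; try exact: rkhs0_L2.
  by apply: L2Z; exact: rkhs0_L2.
pose E f N := \sum_(k < N) (mu k)^-1 * theta f k ^+ 2.
have lim : (fun N => 2^-1 * (E (fun x => 1 * g x + h x) N - E g N - E h N))
    @ \oo --> ip g h.
  rewrite ipgh; apply: cvgM; first exact: cvg_cst.
  apply: (@cvgB _ R^o); last exact: eigen_norm_cvg.
  by apply: (@cvgB _ R^o); exact: eigen_norm_cvg.
apply: cvg_trans lim; apply: near_eq_cvg; apply: nearW => N /=.
rewrite /E -!sumrB mulr_sumr; apply: eq_bigr => k _.
by rewrite thD; move: (mu k)^-1 => m; field.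
Qed.

(** [eigen_ip_cvg] for g and the section of the kernel at x: the reproducing
    property identifies the limit as g x, and the coefficients of the section are
    mu k * psi k x, so that the eigenvalues cancel. *)
Lemma eigen_expansion g x : H0 g -> x \in `[0, 1] ->
  (fun N => \sum_(k < N) theta g k * psi k x) @ \oo --> g x.
Proof.
move=> Hg x01; have [K0 rk me] := rkhs0_mercer Hrkhs.
rewrite -(rkhs_reproducing rk Hg x01).
have HK : H0 (K0 x) by exact: (rkhs_kernel rk x01).
apply: cvg_trans (eigen_ip_cvg Hg HK).
apply: near_eq_cvg; apply: nearW => N; apply: eq_bigr => k _.
rewrite (mercer_eigen me)//.
have [m0|m0] := eqVneq (mu k) 0.
  by rewrite (theta_eq0 Hg m0) !mul0r mulr0.
by field.
Qed.

Lemma L2_partial_sum g N : H0 g ->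
  L2 leb01 (fun x => \sum_(k < N) theta g k * psi k x).
Proof. by move=> Hg; apply: L2_sum => k _; apply: L2Z; exact: eigen_L2. Qed.

Lemma L2ip_partial_sum g N : H0 g ->
  L2ip leb01 (fun x => \sum_(k < N) theta g k * psi k x)
             (fun x => \sum_(k < N) theta g k * psi k x) =
  \sum_(k < N) theta g k ^+ 2.
Proof.
move=> Hg; have [K0 rk me] := rkhs0_mercer Hrkhs.
pose f (k : 'I_N) (x : measurableTypeR R) := theta g k * psi k x.
have f2 k : true -> L2 leb01 (f k) by move=> _; apply: L2Z; exact: eigen_L2.
rewrite (L2ip_suml _ f2); last exact: L2_partial_sum.
apply: eq_bigr => k _; rewrite L2ipZl; [|exact: eigen_L2|exact: L2_partial_sum].
rewrite [X in _ * X]L2ipC (L2ip_suml _ f2); last exact: eigen_L2.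
rewrite (bigD1 k)//= L2ipZl; [|exact: eigen_L2..].
rewrite (mercer_orthonormal me) eqxx mulr1 big1 ?addr0; first by rewrite expr2.
move=> l lk; rewrite L2ipZl; [|exact: eigen_L2..].
by rewrite (mercer_orthonormal me) -[(_ == _)]/(l == k) (negbTE lk) mulr0.
Qed.

(** Beyond level nu each squared coefficient is at most
    mu nu times its term in the squared norm, because mu k <= mu nu; where
    mu k = 0 the coefficient itself vanishes. *)
Lemma sum_theta_ub g N nu : H0 g ->
  \sum_(k < N) theta g k ^+ 2 <=
  \sum_(k < nu) theta g k ^+ 2 + mu nu * ip g g.
Proof.
move=> Hg.
have ub M : \sum_(k < M) (mu k)^-1 * theta g k ^+ 2 <= ip g g.
  have nd : nondecreasing_seq (fun N => \sum_(k < N) (mu k)^-1 * theta g k ^+ 2).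
    apply/nondecreasing_seqP => n; rewrite big_ord_recr/= lerDl.
    by rewrite mulr_ge0 ?invr_ge0 ?eigenvalue_ge0 ?sqr_ge0.
  rewrite -(cvg_lim _ (eigen_norm_cvg Hg))//.
  apply: (nondecreasing_cvgn_le nd); apply/cvg_ex; exists (ip g g).
  exact: eigen_norm_cvg.
apply: (@le_trans _ _ (\sum_(k < nu) theta g k ^+ 2 +
    mu nu * \sum_(k < N) (mu k)^-1 * theta g k ^+ 2)); last first.
  by rewrite lerD2l ler_wpM2l ?eigenvalue_ge0.
have t0 k : 0 <= theta g k ^+ 2 by exact: sqr_ge0.
have [Nnu|nuN] := leqP N nu.
  apply: ler_wpDr.
    rewrite mulr_ge0 ?eigenvalue_ge0// sumr_ge0// => k _.
    by rewrite mulr_ge0 ?invr_ge0 ?eigenvalue_ge0.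
  rewrite -!(big_mkord xpredT (fun k => theta g k ^+ 2)).
  by rewrite (big_cat_nat (leq0n N) Nnu)//= lerDl sumr_ge0.
rewrite -!(big_mkord xpredT (fun k => theta g k ^+ 2)).
rewrite -(big_mkord xpredT (fun k => (mu k)^-1 * theta g k ^+ 2)).
rewrite (big_cat_nat (leq0n nu) (ltnW nuN))//= lerD2l.
rewrite (big_cat_nat (leq0n nu) (ltnW nuN))//= mulrDr; apply: ler_wpDl.
  rewrite mulr_ge0 ?eigenvalue_ge0// sumr_ge0// => k _.
  by rewrite mulr_ge0 ?invr_ge0 ?eigenvalue_ge0.
rewrite mulr_sumr big_nat_cond [leRHS]big_nat_cond.
apply: ler_sum => k /andP[/andP[nuk _] _].
have [m0|m0] := eqVneq (mu k) 0.
  by rewrite (theta_eq0 Hg m0) expr0n/= !mulr0.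
have mk : 0 < mu k by rewrite lt_neqAle eq_sym m0 eigenvalue_ge0.
rewrite mulrA ler_peMl// ler_pdivlMr// mul1r.
exact: eigenvalue_nonincreasing.
Qed.

(** Fatou's lemma applied to the squares of the partial sums of the pointwise
    expansion.  Completeness of the eigenfunctions in L^2 is thereby avoided. *)
Lemma L2ip_rkhs0_ub g nu : H0 g ->
  L2ip leb01 g g <= \sum_(k < nu) theta g k ^+ 2 + mu nu * ip g g.
Proof.
move=> Hg; set B := (X in _ <= X).
pose S N x := \sum_(k < N) theta g k * psi k x.
have SE (f : measurableTypeR R -> R) : L2 leb01 f -> ((L2ip leb01 f f)%:E =
    \int[lebesgue_measure]_(x in `[0%R, 1%R]) (f x ^+ 2)%:E)%E.
  move=> f2; rewrite EFin_L2ip// integral_uniform.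
  - by rewrite subr0 invr1 mul1e.
  - by apply/measurable_EFinP; apply: measurable_funX; exact: L2_measurable f2.
  - by move=> x; rewrite lee_fin sqr_ge0.
rewrite -lee_fin SE; last exact: rkhs0_L2.
have S2 N : L2 leb01 (S N) by exact: L2_partial_sum.
have := @fatou _ (measurableTypeR R) R lebesgue_measure `[0, 1]%classic
  (measurable_itv _) (fun N x => (S N x ^+ 2)%:E).
rewrite (eq_integral (fun x : measurableTypeR R => (g x ^+ 2)%:E)); last first.
  move=> x /[!inE] x01; have h : (fun N => (S N x ^+ 2)%:E) @ \oo --> (g x ^+ 2)%:E.
    apply: cvg_EFin; first exact: nearW.
    by apply: cvgM; exact: eigen_expansion.
  by rewrite (cvg_limn_einf_sup h).1.
move=> fatouS; apply: le_trans (fatouS _ _) _.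
- move=> N; apply/measurable_funTS/measurable_EFinP; apply: measurable_funX.
  exact: L2_measurable (S2 N).
- by move=> N x _; rewrite lee_fin sqr_ge0.
rewrite limn_einf_lim; apply: lime_le; first exact: is_cvg_einfs.
apply: nearW => N.
apply: (@le_trans _ _ (\int[lebesgue_measure]_(x in `[0%R, 1%R]) (S N x ^+ 2)%:E)%E).
  by apply: ereal_inf_lbound; exists N => /=.
by rewrite -SE// L2ip_partial_sum// lee_fin sum_theta_ub.
Qed.

End EigenExpansion.

(** * Sums of squares of pairwise jointly Gaussian variables *)

Section SumOfSquares.
Context {R : realType} {d : measure_display} {Om : measurableType d}.
Variables (P : probability Om R) (I : finType) (X : I -> Om -> R) (m : I -> R) (v : R).
Hypotheses (v0 : 0 < v) (mX : forall a, measurable_fun setT (X a)).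
Hypothesis gX : forall a, gaussian P (X a) (m a) v.
Hypothesis gXD : forall a b, a != b ->
  gaussian P (fun w => X a w + X b w) (m a + m b) (v + v).
Hypothesis gXB : forall a b, a != b ->
  gaussian P (fun w => X a w - X b w) (m a - m b) (v + v).

Let Yc a w := X a w ^+ 2 + - (m a ^+ 2 + v).

Lemma L2_gaussian_sqr a : L2 P (fun w => X a w ^+ 2).
Proof.
apply: L2P; first exact: measurable_funX.
under eq_fun do rewrite -exprM.
exact: (gaussian_integrable v0 (mX a) (gX a) 4).
Qed.

Let L2c (c : R) : L2 P (fun=> c). Proof. exact: Lfun_cst. Qed.

Let L2Yc a : L2 P (Yc a).
Proof. by apply: L2D; [exact: L2_gaussian_sqr|exact: L2c]. Qed.

Let ip_sqr1 a (c : R) : L2ip P (fun w => X a w ^+ 2) (fun=> c) = c * (m a ^+ 2 + v).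
Proof.
rewrite -(gaussian_sqr v0 (mX a) (gX a)) -RintegralZl//.
  by apply: eq_Rintegral => w _; rewrite mulrC.
exact: (gaussian_integrable v0 (mX a) (gX a) 2).
Qed.

Let ip_cst (c c' : R) : L2ip P (fun=> c) (fun=> c') = c * c'.
Proof.
rewrite /L2ip Rintegral_cst// (_ : fine _ = 1) ?mulr1//.
exact: (congr1 fine (probability_setT P)).
Qed.

Let ip_Yc a b : L2ip P (Yc a) (Yc b) =
  L2ip P (fun w => X a w ^+ 2) (fun w => X b w ^+ 2) -
  (m a ^+ 2 + v) * (m b ^+ 2 + v).
Proof.
have s2 := L2_gaussian_sqr.
rewrite L2ipDl// (L2ipC _ (fun w => X a w ^+ 2) (Yc b)) (L2ipC _ (fun=> _) (Yc b)).
rewrite !L2ipDl// (L2ipC _ (fun w => X b w ^+ 2) (fun w => X a w ^+ 2)).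
by rewrite (L2ipC _ (fun=> - (m b ^+ 2 + v))) !ip_sqr1 ip_cst; ring.
Qed.

(** Writing x^2 y^2 through (x + y)^4, (x - y)^4, x^4 and y^4 reduces the mixed
    moment to Gaussian fourth moments. *)
Lemma gaussian_sqr_uncorrelated a b : a != b ->
  L2ip P (fun w => X a w ^+ 2) (fun w => X b w ^+ 2) =
  (m a ^+ 2 + v) * (m b ^+ 2 + v).
Proof.
move=> ab; have v2 : 0 < v + v by rewrite addr_gt0.
have mD : measurable_fun setT (fun w => X a w + X b w) by exact: measurable_funD.
have mB : measurable_fun setT (fun w => X a w - X b w) by exact: measurable_funB.
have iX e := gaussian_integrable v0 (mX e) (gX e) 4.
have iD := gaussian_integrable v2 mD (gXD ab) 4.
have iB := gaussian_integrable v2 mB (gXB ab) 4.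
have fX e := gaussian_fourth v0 (mX e) (gX e).
have /= fD := gaussian_fourth v2 mD (gXD ab).
have /= fB := gaussian_fourth v2 mB (gXB ab).
have polar : \int[P]_w (((X a w + X b w) ^+ 4 + (X a w - X b w) ^+ 4)) =
    \int[P]_w (12 * (X a w ^+ 2 * X b w ^+ 2) + (2 * X a w ^+ 4 + 2 * X b w ^+ 4)).
  by apply: eq_Rintegral => w _; ring.
have iZ (c : R) (f : Om -> R) : P.-integrable setT (EFin \o f) ->
    P.-integrable setT (EFin \o (fun w => c * f w)).
  by move=> fi; exact: (integrableZl measurableT c fi).
have iab := L2_integrableM (L2_gaussian_sqr a) (L2_gaussian_sqr b).
have i2 := integrableD measurableT (iZ 2 _ (iX a)) (iZ 2 _ (iX b)).
move: polar; rewrite RintegralD// RintegralD//; last exact: iZ.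
rewrite RintegralD//; [|exact: iZ _ _ (iX _)..].
have Zl (c : R) (f : Om -> R) : P.-integrable setT (EFin \o f) ->
    \int[P]_w (c * f w) = c * \int[P]_w f w by move=> fi; exact: RintegralZl.
rewrite fD fB (Zl _ _ iab) (Zl _ _ (iX a)) (Zl _ _ (iX b)) !fX.
rewrite -/(L2ip P _ _) => polar.
have {}polar : 12 * L2ip P (fun w => X a w ^+ 2) (fun w => X b w ^+ 2) =
    12 * ((m a ^+ 2 + v) * (m b ^+ 2 + v)).
  by move: polar => /eqP; rewrite -subr_eq => /eqP <-; ring.
by apply: (mulfI _ polar); rewrite pnatr_eq0.
Qed.

Let W w := \sum_a X a w ^+ 2.
Let EW := \sum_a (m a ^+ 2 + v).

Lemma variance_sum_sqr :
  L2ip P (fun w => \sum_a Yc a w) (fun w => \sum_a Yc a w) =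
  \sum_a (4 * m a ^+ 2 * v + 2 * v ^+ 2).
Proof.
have s2 : L2 P (fun w => \sum_a Yc a w) by exact: L2_sum.
rewrite (L2ip_suml _ (f := Yc))//; apply: eq_bigr => a _.
rewrite L2ipC (L2ip_suml _ (f := Yc))// (bigD1 a)//= big1 ?addr0; last first.
  by move=> b ba; rewrite ip_Yc gaussian_sqr_uncorrelated// subrr.
rewrite ip_Yc.
have -> : L2ip P (fun w => X a w ^+ 2) (fun w => X a w ^+ 2) = \int[P]_w (X a w ^+ 4).
  by apply: eq_Rintegral => w _; ring.
by rewrite (gaussian_fourth v0 (mX a) (gX a)); ring.
Qed.

Lemma sum_sqr_deviation (t : R) : 0 < t ->
  (P [set w | (t <= `|W w - EW|)%R] <=
   ((\sum_a (4 * m a ^+ 2 * v + 2 * v ^+ 2)) / t ^+ 2)%:E)%E.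
Proof.
move=> t0; rewrite -variance_sum_sqr.
have := chebyshev_L2 (Z := fun w => \sum_a Yc a w) t0 (L2_sum _ (fun a _ => L2Yc a)).
apply: le_trans; rewrite le_eqVlt; apply/predU1P; left; congr (P _).
by apply/seteqP; split => w /=; rewrite /Yc big_split/= sumrN.
Qed.

End SumOfSquares.

Section WhiteNoiseCoordinates.
Context {R : realType} {d : measure_display} {Om : measurableType d}.
Variables (p n : nat) (P : (Rpow R p -> R) -> probability Om R).
Variable Y : (Rpow R p -> R) -> Om -> R.
Hypothesis wn : white_noise_model n P Y.
Notation cube := (cube_measure p : probability (Rpow R p) R).

Lemma white_noise1 f h : L2 cube f -> L2 cube h ->
  gaussian (P f) (Y h) (L2ip cube f h) (L2ip cube h h / n%:R).
Proof.
move=> f2 h2; have := white_noise_law wn f2 (h := fun _ : 'I_1 => h) (fun=> 1) (fun=> h2).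
rewrite (_ : (fun x => \sum_(i < 1) 1 * h x) = h); last first.
  by apply/funext => x; rewrite big_ord1 mul1r.
rewrite (_ : (fun x => \sum_(i < 1) 1 * Y h x) = Y h)//.
by apply/funext => x; rewrite big_ord1 mul1r.
Qed.

(** Polarization of the variance: the law of a combination of two observations
    carries their covariance. *)
Lemma white_noise2 f h h' (c : R) : L2 cube f -> L2 cube h -> L2 cube h' ->
  gaussian (P f) (fun w => Y h w + c * Y h' w)
    (L2ip cube f h + c * L2ip cube f h')
    ((L2ip cube h h + c ^+ 2 * L2ip cube h' h' + 2 * c * L2ip cube h h') / n%:R).
Proof.
move=> f2 h2 h'2.
pose hh (i : 'I_2) := if i == ord0 then h else h'.
pose cc (i : 'I_2) : R := if i == ord0 then 1 else c.
have hh2 i : L2 cube (hh i) by rewrite /hh; case: ifP.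
have := white_noise_law wn f2 cc hh2.
rewrite (_ : (fun x => \sum_(i < 2) cc i * hh i x) =
    (fun x => h x + c * h' x)); last first.
  by apply/funext => x; rewrite !big_ord_recl big_ord0 /hh /cc/= mul1r addr0.
rewrite (_ : (fun w => \sum_(i < 2) cc i * Y (hh i) w) =
    (fun w => Y h w + c * Y h' w)); last first.
  by apply/funext => x; rewrite !big_ord_recl big_ord0 /hh /cc/= mul1r addr0.
have ch'2 := L2Z c h'2; have s2 := L2D h2 ch'2.
have ipr g : L2 cube g -> L2ip cube g (fun x => h x + c * h' x) =
    L2ip cube g h + c * L2ip cube g h'.
  move=> g2; rewrite L2ipC L2ipDl// L2ipZl//; congr (_ + _ * _); exact: L2ipC.
rewrite /= (ipr f f2) (ipr _ s2) [X in (X + _) / _]L2ipC [X in (_ + c * X) / _]L2ipC.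
rewrite (ipr h h2) (ipr h' h'2) (L2ipC _ h' h) => gh.
rewrite (_ : _ + c ^+ 2 * _ + _ = L2ip cube h h + c * L2ip cube h h' +
  c * (L2ip cube h h' + c * L2ip cube h' h'))//.
by ring.
Qed.

End WhiteNoiseCoordinates.

(** * The truncated energy statistic in the white noise model *)

Section Detection.
Context {R : realType} {d : measure_display} {Om : measurableType d}.
Variables (p n nu : nat) (H : set (R -> R)) (ip : (R -> R) -> (R -> R) -> R).
Variables (mu : nat -> R) (psi : nat -> R -> R).
Hypothesis Hrkhs : additive_rkhs H ip mu psi.
Variables (P : (Rpow R p -> R) -> probability Om R).
Variable Y : (Rpow R p -> R) -> Om -> R.
Hypothesis wn : white_noise_model n P Y.
Hypothesis n0 : (0 < n)%N.
Notation cube := (cube_measure p : probability (Rpow R p) R).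
Notation theta g k := (L2ip leb01 g (psi k)).

Definition basis (a : 'I_p * 'I_nu) (x : Rpow R p) : R := psi a.2 (tnth x a.1).

(** Squared norm of the projection of f on the span of the observed basis
    functions. *)
Definition energy (f : Rpow R p -> R) : R := \sum_a L2ip cube f (basis a) ^+ 2.

Let psi2 k : L2 leb01 (psi k). Proof. exact: (eigen_L2 Hrkhs). Qed.

Lemma basis_L2 a : L2 cube (basis a).
Proof. exact: L2_coord. Qed.

Lemma basis_orthonormal a b : L2ip cube (basis a) (basis b) = (a == b)%:R.
Proof.
have [K0 _ me] := rkhs0_mercer Hrkhs.
case: a b => [i k] [j l]; rewrite -pair_eqE /=.
have [<-|ij] := eqVneq i j; first by rewrite L2ip_coord// (mercer_orthonormal me).
by rewrite L2ip_coord2// (eigen_perp1 Hrkhs) mul0r.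
Qed.

Lemma measurable_Y h : L2 cube h -> measurable_fun setT (Y h).
Proof. exact: (white_noise_measurable wn). Qed.

Let W w := \sum_(a : 'I_p * 'I_nu) Y (basis a) w ^+ 2.

Lemma test_statE w : test_stat psi n nu Y w = n%:R * W w.
Proof. by congr (_ * _); rewrite pair_bigA. Qed.

(** [sum_sqr_deviation] with all variances equal to 1 / n and p * nu terms. *)
Lemma test_stat_deviation f t : L2 cube f -> 0 < t ->
  (P f [set w | (t <= `|W w - (energy f + p%:R * nu%:R / n%:R)|)%R] <=
   ((4 * energy f / n%:R + 2 * (p%:R * nu%:R) / n%:R ^+ 2) / t ^+ 2)%:E)%E.
Proof.
move=> f2 t0; have v0 : 0 < n%:R^-1 :> R by rewrite invr_gt0 ltr0n.
have b2 := basis_L2.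
have g1 a : gaussian (P f) (Y (basis a)) (L2ip cube f (basis a)) n%:R^-1.
  have := white_noise1 wn f2 (b2 a).
  by rewrite basis_orthonormal eqxx mul1r.
have gc c a b : c ^+ 2 = 1 -> a != b -> gaussian (P f)
    (fun w => Y (basis a) w + c * Y (basis b) w)
    (L2ip cube f (basis a) + c * L2ip cube f (basis b)) (n%:R^-1 + n%:R^-1).
  move=> c1 ab; have := white_noise2 wn c f2 (b2 a) (b2 b).
  by rewrite !basis_orthonormal !eqxx (negbTE ab) c1 mulr0 addr0 mul1r mulrDl mul1r.
have gD a b : a != b -> gaussian (P f) (fun w => Y (basis a) w + Y (basis b) w)
    (L2ip cube f (basis a) + L2ip cube f (basis b)) (n%:R^-1 + n%:R^-1).
  move=> ab; have := gc 1 a b (expr1n _ _) ab; rewrite mul1r.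
  by under eq_fun do rewrite mul1r.
have gB a b : a != b -> gaussian (P f) (fun w => Y (basis a) w - Y (basis b) w)
    (L2ip cube f (basis a) - L2ip cube f (basis b)) (n%:R^-1 + n%:R^-1).
  move=> ab; have := gc (-1) a b _ ab; rewrite sqrrN expr1n mulN1r => /(_ erefl).
  by under eq_fun do rewrite mulN1r.
have mY a := measurable_Y (b2 a).
have := sum_sqr_deviation v0 mY g1 gD gB t0.
have cardE (c : R) : \sum_(a : 'I_p * 'I_nu) c = p%:R * nu%:R * c.
  by rewrite -natrM mulr_natl sumr_const card_prod !card_ord.
rewrite !big_split/= !cardE -/(energy f).
rewrite (_ : \sum_a 4 * _ ^+ 2 * _ = 4 * energy f / n%:R); last first.
  by rewrite /energy mulr_sumr mulr_suml.
by rewrite (_ : _ * (2 * n%:R^-1 ^+ 2) = 2 * (p%:R * nu%:R) / n%:R ^+ 2) // exprVn; ring.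
Qed.

Lemma measurable_sum_sqr : measurable_fun setT W.
Proof.
apply: measurable_sum => a; apply: measurable_funX.
exact: (measurable_Y (basis_L2 a)).
Qed.

Lemma test_stat_prob_le f (A : set Om) t b : L2 cube f -> 0 < t ->
  measurable A ->
  A `<=` [set w | t <= `|W w - (energy f + p%:R * nu%:R / n%:R)|] ->
  4 * energy f / n%:R + 2 * (p%:R * nu%:R) / n%:R ^+ 2 <= b * t ^+ 2 ->
  (P f A <= b%:E)%E.
Proof.
move=> f2 t0 mA AW bt; apply: (le_trans (le_measure (P f) _ _ AW)); rewrite ?inE//.
  apply: measurable_preimage_ge; apply: measurableT_comp => //.
  by apply: measurable_funB => //; exact: measurable_sum_sqr.
apply: le_trans (test_stat_deviation f2 t0) _.
by rewrite lee_fin ler_pdivrMr// exprn_gt0.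
Qed.

Section signal.
Variables (s : nat) (f : Rpow R p -> R).
Hypothesis fF : Fs H ip s f.

Lemma Fs_L2 : L2 cube f.
Proof.
have [S _ [g [Hg ->]]] := fF.
apply: L2_sum => j jS; apply: L2_coord; exact: (rkhs0_L2 Hrkhs (Hg _ jS).1).
Qed.

(** The components are centered functions of distinct coordinates, hence
    orthogonal, and each loses at most mu nu by truncation. *)
Lemma signal_energy : L2ip cube f f <= energy f + s%:R * mu nu.
Proof.
have [S Ss [g [Hg fE]]] := fF.
have g2 j : j \in S -> L2 leb01 (g j) by move=> jS; exact: (rkhs0_L2 Hrkhs (Hg _ jS).1).
pose G j (x : Rpow R p) := g j (tnth x j).
have G2 j : j \in S -> L2 cube (G j) by move=> jS; apply: L2_coord; exact: g2.
have f2 := Fs_L2.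
have ip1 j h : j \in S -> perp1 h -> L2 leb01 h ->
    L2ip cube f (fun x => h (tnth x j)) = L2ip leb01 (g j) h.
  move=> jS h1 h2; rewrite {1}fE (L2ip_suml _ (f := G))//; last exact: L2_coord.
  rewrite (bigD1 j)//= L2ip_coord//; last exact: g2.
  rewrite big1 ?addr0// => i /andP[iS ij].
  by rewrite L2ip_coord2//; [rewrite h1 mulr0|exact: g2].
have normE : L2ip cube f f = \sum_(j in S) L2ip leb01 (g j) (g j).
  rewrite {1}fE (L2ip_suml _ (f := G))//; apply: eq_bigr => j jS.
  by rewrite L2ipC ip1//; [exact: (Hg _ jS).1.2|exact: g2].
rewrite normE.
apply: (@le_trans _ _ (\sum_(j in S) (\sum_(k < nu) theta (g j) k ^+ 2 + mu nu))).
  apply: ler_sum => j jS; have [Hj nj] := Hg _ jS.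
  apply: le_trans (L2ip_rkhs0_ub Hrkhs nu Hj) _.
  rewrite lerD2l ler_piMr// ?(eigenvalue_ge0 Hrkhs)//.
  rewrite -(sqr_sqrtr (rkhs0_ip_ge0 Hrkhs Hj)).
  by rewrite -[leRHS](expr1n _ 2) ler_sqr ?nnegrE ?sqrtr_ge0.
rewrite big_split/=; apply: lerD; last first.
  rewrite sumr_const -[leLHS]mulr_natl ler_wpM2r ?(eigenvalue_ge0 Hrkhs)//.
  by rewrite ler_nat.
rewrite /energy -(pair_bigA _ (fun j k => L2ip cube f (basis (j, k)) ^+ 2))/=.
rewrite [leRHS](bigID (mem S))/= ler_wpDr//.
  by apply: sumr_ge0 => j _; apply: sumr_ge0 => k _; exact: sqr_ge0.
rewrite le_eqVlt; apply/predU1P; left.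
apply: eq_bigr => j jS; apply: eq_bigr => k _; congr (_ ^+ 2).
by rewrite ip1// ; exact: (eigen_perp1 Hrkhs).
Qed.

End signal.

(** From log (1 + p / s^2) <= p / s^2, since s * sqrt (nu p / s^2) = sqrt (p nu). *)
Lemma truncation_tail s : (0 < s)%N -> truncation_cond mu p s n nu ->
  s%:R * mu nu <= Num.sqrt (p%:R * nu%:R) / n%:R.
Proof.
move=> s0 tc.
have sR : 0 < s%:R :> R by rewrite ltr0n.
have nR : 0 < n%:R :> R by rewrite ltr0n.
apply: (@le_trans _ _ (s%:R * (Num.sqrt (nu%:R * (p%:R / s%:R ^+ 2)) / n%:R))).
  rewrite ler_pM2l//; apply: le_trans (le_trans tc _).
    by apply: (eigenvalue_nonincreasing Hrkhs); exact: leq_pred.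
  rewrite ler_pM2r ?invr_gt0// ler_wsqrtr// ler_wpM2l//.
  by apply: le_ln1Dx; rewrite (lt_le_trans (ltrN10 R))// divr_ge0// exprn_ge0.
rewrite mulrA ler_pM2r ?invr_gt0//.
rewrite -{1}(ger0_norm (ltW sR)) -sqrtr_sqr -sqrtrM ?sqr_ge0//.
by rewrite le_eqVlt; apply/predU1P; left; congr Num.sqrt; field; rewrite gt_eqF.
Qed.

End Detection.

Unset Implicit Arguments.

Theorem proposition4 (R : realType) (eta : R) (eta_gt0 : 0 < eta) (eta_lt1 : eta < 1) :
  exists2 Ceta : R, 0 < Ceta &
  forall (p n s : nat), (0 < p)%N -> (0 < n)%N -> (0 < s)%N ->
    Num.sqrt p%:R <= s%:R :> R -> (s <= p)%N ->
  forall (H : set (R -> R)) (ip : (R -> R) -> (R -> R) -> R)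
    (mu : nat -> R) (psi : nat -> R -> R), additive_rkhs H ip mu psi ->
  forall nu : nat, is_truncation_level mu p s n nu ->
  forall (d : measure_display) (Om : measurableType d)
    (P : (Rpow R p -> R) -> probability Om R)
    (Y : (Rpow R p -> R) -> Om -> R), white_noise_model n P Y ->
  forall C : R, Ceta < C ->
  (P (fun=> 0%R) [set w | (threshold eta p nu < test_stat psi n nu Y w)%R]
   + nneg_sup [set f | Fs H ip s f /\
                   (C * tau p n nu)%:E <= 'N[cube_measure p]_2%:E[EFin \o f]]
       (fun f => P f [set w | (test_stat psi n nu Y w <= threshold eta p nu)%R])
   <= eta%:E)%E.
Proof.
(* For C beyond this value n M >= (64 / eta) sqrt N, which dominates both the margin of the
   threshold and the two terms of the variance. *)
exists (Num.sqrt (1 + 64 / eta)).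
  by rewrite sqrtr_gt0 addr_gt0// divr_gt0.
move=> p n s p0 n0 s0 _ _ H ip mu psi Hrkhs nu [nu0 tc _] d Om P Y wn C CC.
have nR : 0 < n%:R :> R by rewrite ltr0n.
set Q : R := Num.sqrt (p%:R * nu%:R).
have pnu1 : 1 <= p%:R * nu%:R :> R by rewrite -natrM ler1n muln_gt0 p0.
have Q2 : p%:R * nu%:R = Q ^+ 2 by rewrite sqr_sqrtr// (le_trans ler01).
have Q1 : 1 <= Q by rewrite -[leLHS]sqrtr1 ler_wsqrtr.
have Q0 : 0 < Q := lt_le_trans ltr01 Q1.
set r := Num.sqrt eta.
have r0 : 0 < r by rewrite sqrtr_gt0.
have r2 : eta = r ^+ 2 by rewrite sqr_sqrtr// ltW.
have r1 : r < 1 by rewrite -[ltRHS]sqrtr1 ltr_sqrt.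
have thr : threshold eta p nu = Q ^+ 2 + 2 / r * Q by rewrite /threshold -/Q Q2.
pose W w := \sum_(a : 'I_p * 'I_nu) Y (basis psi a) w ^+ 2.
have mW : measurable_fun setT W by exact: (measurable_sum_sqr nu Hrkhs wn).
have TE w : test_stat psi n nu Y w = n%:R * W w by exact: test_statE.
have -> : eta%:E = ((eta / 2)%:E + (eta / 2)%:E)%E by rewrite -EFinD -splitr.
apply: leeD.
  pose c := (Q ^+ 2 + 2 / r * Q) / n%:R.
  have setE : [set w | (threshold eta p nu < test_stat psi n nu Y w)%R] =
      ~` [set w | W w <= c].
    apply/seteqP; split => w /=; rewrite thr TE /c ler_pdivlMr// [W w * _]mulrC.
      by move=> h; apply/negP; rewrite -ltNge.
    by move=> /negP; rewrite -ltNge.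
(* First error: no signal, hence no energy. *)
  have e0 : @energy R p nu psi (fun=> 0) = 0.
    rewrite /energy big1// => a _; rewrite (_ : L2ip _ _ _ = 0) ?expr0n//.
    rewrite /L2ip; under eq_Rintegral do rewrite mul0r.
    by rewrite Rintegral_cst// mul0r.
  have t0 : 0 < 2 / r * Q / n%:R by rewrite !mulr_gt0// invr_gt0.
  rewrite setE; apply: (test_stat_prob_le (nu := nu) Hrkhs wn n0 (L2_0 _) t0).
  - by apply: measurableC; exact: measurable_preimage_le.
  - move=> w /= /negP; rewrite -ltNge e0 add0r Q2 /c mulrDl => Wc.
    by apply: le_trans (ler_norm _); rewrite -/(W w); lra.
  - rewrite e0 Q2 r2 le_eqVlt; apply/predU1P; left.
    by field; rewrite !gt_eqF.
apply: ge_ereal_sup => _ [->|[f [fF fC] <-]].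
  by rewrite lee_fin divr_ge0// ltW.
(* Second error, uniformly over the alternative. *)
have f2 := Fs_L2 Hrkhs fF.
set M := energy nu psi f.
have Ceta1 : 64 / eta <= C ^+ 2 - 1.
  rewrite lerBrDl -(@sqr_sqrtr _ (1 + 64 / eta)); last first.
    by rewrite addr_ge0// divr_ge0// ltW.
  by rewrite ler_sqr ?nnegrE ?sqrtr_ge0 ?ltW// (le_lt_trans (sqrtr_ge0 _) CC).
have C0 : 0 <= C by rewrite (le_trans (sqrtr_ge0 _) (ltW CC)).
have signal : C ^+ 2 * (Q / n%:R) <= M + Q / n%:R.
  apply: le_trans (le_trans (signal_energy nu Hrkhs fF) _).
    rewrite -[X in _ * X]sqr_sqrtr; last by rewrite divr_ge0// ltW.
    by rewrite -exprMn; apply: Lnorm2_ge => //; rewrite mulr_ge0// sqrtr_ge0.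
  by rewrite lerD2l; exact: (truncation_tail Hrkhs).
pose L := n%:R * M.
have ML : M = L / n%:R by rewrite /L mulrAC mulfV ?mul1r// gt_eqF.
have LQ : 64 * Q <= eta * L.
  have : (C ^+ 2 - 1) * Q <= L.
    move: signal; rewrite ML mulrA -mulrDl ler_pM2r ?invr_gt0// => h; lra.
  move=> h; have -> : 64 * Q = eta * (64 / eta * Q) by field; rewrite gt_eqF.
  by rewrite ler_pM2l//; apply: le_trans h; rewrite ler_pM2r.
have L0 : 0 < L by rewrite -(pmulr_rgt0 _ eta_gt0); apply: lt_le_trans LQ; lra.
have t0 : 0 < M / 2 by rewrite ML !divr_gt0.
pose c := (Q ^+ 2 + 2 / r * Q) / n%:R.
have -> : [set w | (test_stat psi n nu Y w <= threshold eta p nu)%R] =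
    [set w | W w <= c].
  by apply/seteqP; split => w /=; rewrite thr TE /c ler_pdivlMr// [W w * _]mulrC.
apply: (test_stat_prob_le (nu := nu) Hrkhs wn n0 f2 t0).
- exact: measurable_preimage_le.
- move=> w /= Wc; rewrite Q2 -/M.
  (* The margin of the threshold is at most half of the mean shift: eta <= r
     because r = sqrt eta < 1. *)
  have rQ : 2 / r * Q <= L / 2.
    rewrite -(ler_pM2l r0) (_ : r * (2 / r * Q) = 2 * Q); last by field; rewrite gt_eqF.
    have : eta * L <= r * L by rewrite ler_pM2r// r2 expr2 ler_piMl// ltW.
    by lra.
  have rQn : 2 / r * Q / n%:R <= M / 2 by rewrite ML (mulrAC L) ler_pM2r ?invr_gt0.
  rewrite -normrN; apply: le_trans (ler_norm _); rewrite -/(W w).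
  by move: Wc; rewrite /c mulrDl; lra.
- rewrite -/M Q2 ML.
  rewrite -subr_ge0 (_ : _ - _ =
    (eta * L ^+ 2 / 8 - 4 * L - 2 * Q ^+ 2) / n%:R ^+ 2); last first.
    by field; rewrite gt_eqF.
  rewrite divr_ge0 ?sqr_ge0//.
  have h1 : 64 * L <= eta * L ^+ 2 by rewrite expr2 mulrA ler_pM2r//; lra.
  have h2 : (64 * Q) ^+ 2 <= eta * L ^+ 2.
    apply: (@le_trans _ _ ((eta * L) ^+ 2)).
      by rewrite ler_sqr// nnegrE mulr_ge0// ltW.
    by rewrite exprMn ler_pM2r ?exprn_gt0// expr2 ler_piMl// ltW.
  by move: h2; rewrite exprMn; lra.
Qed.
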